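(* For $K\ge 1$ let $\Theta_K$ denote the $(K-1)$-simplex and, for cell counts $N=(N_1,\ldots,N_K)$ of nonnegative integers, let the Dirichlet-DSM posterior be the random set $$\mathbf e_N(Z)=\{\theta\in\Theta_K:\ \theta_1\ge Z_1,\ldots,\theta_K\ge Z_K\},\qquad (Z_0,Z_1,\ldots,Z_K)\sim\mathrm{Dirichlet}(1,N_1,\ldots,N_K).$$ For an assertion $A\subseteq\Theta_K$ define $p=\Pr(\mathbf e_N(Z)\subseteq A)$, $q=\Pr(\mathbf e_N(Z)\subseteq A^c)$, $r=1-p-q$. Let $P=\{i_1,\ldots,i_L\}$ be any partition of $\{1,\ldots,K\}$ into $L$ nonempty blocks, and for $\theta\in\Theta_K$ define the aggregate $\tilde\theta\in\Theta_L$ by $\tilde\theta_\ell=\sum_{k\in i_\ell}\theta_k$; similarly $\tilde N_\ell=\sum_{k\in i_\ell}N_k$. Then the Dirichlet-DSM is representation invariant: for every partition $P$ and every assertion $\tilde A\subseteq\Theta_L$, the triple $(p,q,r)$ for the assertion $A=\{\theta\in\Theta_K:\tilde\theta\in\tilde A\}$ computed from the Dirichlet-DSM with counts $N$ equals the triple $(p,q,r)$ for $\tilde A$ computed from the Dirichlet-DSM on $\Theta_L$ with counts $\tilde N$.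
   Context: The Dirichlet distribution with some parameters equal to zero is understood in the degenerate sense: a coordinate whose parameter is $0$ equals $0$ almost surely. $A^c$ denotes the complement of $A$ in the relevant simplex. *)

(* Defs.v *)
From HB Require Import structures.
From mathcomp Require Import all_boot all_order all_algebra.
From mathcomp Require Import all_classical all_reals all_analysis.
Set Implicit Arguments. Unset Strict Implicit. Unset Printing Implicit Defensive.
Import Order.TTheory GRing.Theory Num.Theory.
Local Open Scope classical_set_scope.
Local Open Scope ring_scope.

Section Dirichlet.
Variable R : realType.

Definition simplex (K : nat) : set ('I_K -> R) :=
  [set th | (forall k, 0 <= th k) /\ \sum_(k < K) th k = 1].

Fixpoint iter_lebesgue (m : nat) (f : seq R -> \bar R) : \bar R :=
  match m with
  | 0 => f [::]
  | m'.+1 => (\int[@lebesgue_measure R]_x iter_lebesgue m' (fun v => f (x :: v)))%E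
  end.

(* Random vectors (Z_0, Z_1, ..., Z_K) are functions 'I_K.+1 -> R, with
   Z_0 at index ord0 and Z_k at index lift ord0 (k-1). *)

Definition free_coords (K : nat) (N : 'I_K -> nat) : seq 'I_K :=
  [seq k <- enum 'I_K | (0 < N k)%N].

(* The point of R^{K+1} determined by the values v of the free coordinates:
   Z_k = 0 when N_k = 0 (degenerate Dirichlet), Z_0 = 1 - sum_k Z_k. *)
Definition dir_point (K : nat) (N : 'I_K -> nat) (v : seq R) : 'I_K.+1 -> R :=
  let zk := fun k : 'I_K =>
    if (0 < N k)%N then nth 0 v (index k (free_coords N)) else 0 in
  fun i => match unlift ord0 i with
           | Some k => zk k
           | None => 1 - \sum_(k < K) zk k
           end.

(* Density of Dirichlet(1, N_1, ..., N_K) w.r.t. Lebesgue measure on the free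
   coordinates:  Gamma(1 + sum N) / (Gamma(1) prod_{N_k>0} Gamma(N_k))
                 * Z_0^(1-1) * prod_{N_k>0} Z_k^(N_k - 1)
   on the open support {Z_k > 0 for free k, Z_0 > 0}, 0 elsewhere. *)
Definition dir_density (K : nat) (N : 'I_K -> nat) (z : 'I_K.+1 -> R) : R :=
  if [&& [forall k : 'I_K, (0 < N k)%N ==> (0 < z (lift ord0 k))] & 0 < z ord0]
  then ((\sum_(k < K) N k)`!)%:R / (\prod_(k < K | (0 < N k)%N) ((N k).-1)`!)%:R
       * \prod_(k < K | (0 < N k)%N) z (lift ord0 k) ^+ (N k).-1
  else 0.

Definition dirichlet1 (K : nat) (N : 'I_K -> nat) (E : set ('I_K.+1 -> R))
  : \bar R :=
  iter_lebesgue (size (free_coords N))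
    (fun v => (\1_E (dir_point N v) * dir_density N (dir_point N v))%:E).

Definition dsm_set (K : nat) (z : 'I_K.+1 -> R) : set ('I_K -> R) :=
  [set th | @simplex K th /\ forall k : 'I_K, z (lift ord0 k) <= th k].

Definition dsm_p (K : nat) (N : 'I_K -> nat) (A : set ('I_K -> R)) : \bar R :=
  dirichlet1 N [set z | @dsm_set K z `<=` A].
Definition dsm_q (K : nat) (N : 'I_K -> nat) (A : set ('I_K -> R)) : \bar R :=
  dirichlet1 N [set z | @dsm_set K z `<=` @simplex K `\` A].
Definition dsm_pqr (K : nat) (N : 'I_K -> nat) (A : set ('I_K -> R))
  : \bar R * \bar R * \bar R :=
  (dsm_p N A, dsm_q N A, (1 - dsm_p N A - dsm_q N A)%E).

(* Aggregation along a partition of {1..K} into L blocks, the l-th block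
   being f^{-1}(l) for a surjection f : 'I_K -> 'I_L. *)
Definition agg (K L : nat) (f : 'I_K -> 'I_L) (th : 'I_K -> R) : 'I_L -> R :=
  fun l => \sum_(k < K | f k == l) th k.
End Dirichlet.

Definition agg_counts (K L : nat) (f : 'I_K -> 'I_L) (N : 'I_K -> nat)
  : 'I_L -> nat :=
  fun l => (\sum_(k < K | f k == l) N k)%N.

(* Main.v *)
Require Import Defs.
From HB Require Import structures.
From mathcomp Require Import all_boot all_order all_algebra.
From mathcomp Require Import all_classical all_reals all_analysis.
From mathcomp Require Import measurable_realfun ring lra.
Import Order.TTheory GRing.Theory Num.Theory numFieldNormedType.Exports.
Local Open Scope classical_set_scope.
Local Open Scope ring_scope.

(* A Dirichlet(1, N) probability is (sum N)! times the integral over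
   {sum z < 1} against the product of the measures x^(N_k - 1)/(N_k - 1)! dx on
   x > 0 (a Dirac mass at 0 when N_k = 0). The measure attached to a count n is the
   n-th convolution power of Lebesgue measure on the half line, so attaching it to
   the coordinate f k of the aggregate for each k applies the operator attached to
   a unit count in coordinate l exactly sum_{f k = l} N_k times, whatever the
   order. Since aggregation maps {theta >= z} onto {theta~ >= z~}, both
   probabilities are obtained from the same function by the same operators.

   The assertion is arbitrary, so the events need not be Borel and Tonelli's
   theorem does not apply directly. But the events are upward closed in z, so the
   integrands are differences of antitone functions: their one-dimensional
   sections are Borel, and an antitone function of two variables has a Borel
   minorant with the same iterated integrals. *)

(** * Integrals over the line: translation, and convolution powers of the half-line indicator *)

Section OneDim.
Context {R : realType}.
Local Notation mu := (@lebesgue_measure R).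

(* No measurability is needed: the integral of a nonnegative function is a supremum
   over the simple functions below it. *)
Lemma le_ge0_integral (f g : R -> \bar R) :
  (forall x, 0 <= f x)%E -> (forall x, f x <= g x)%E ->
  (\int[mu]_x f x <= \int[mu]_x g x)%E.
Proof.
move=> f0 fg; have g0 x : (0 <= g x)%E := le_trans (f0 x) (fg x).
rewrite !ge0_integralTE//; apply: ub_ereal_sup => _ [h hf <-].
by apply: ereal_sup_ubound; exists h => // x; exact: le_trans (hf x) (fg x).
Qed.

(** The preimage of an upper ray is closed downwards, hence an interval, hence Borel. *)
Lemma antitone_measurable (g : R -> \bar R) :
  (forall x y : R, x <= y -> (g y <= g x)%E) -> measurable_fun setT g.
Proof.
move=> ag mD; apply: (measurability _ (ErealGenOInfty.measurableE R)) => //.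
move=> /= _ [_ [a ->]] <-; apply: measurableI => //.
apply: is_interval_measurable => s t /=; rewrite !in_itv/= !andbT => _ gt u /andP[_ ut].
by rewrite in_itv/= andbT (lt_le_trans gt)// ag.
Qed.

(** The pushforward of [mu] under the translation gives each []c, d]] its length, and this
    determines Lebesgue measure. *)
Lemma integral_shift (h : R -> \bar R) (a : R) :
  measurable_fun setT h -> (forall x, 0 <= h x)%E ->
  (\int[mu]_x h (x + a)%R = \int[mu]_x h x)%E.
Proof.
move=> mh h0.
have ms : measurable_fun [set: measurableTypeR R] (fun x : R => x + a : measurableTypeR R).
  by apply: measurable_funD.
transitivity (\int[pushforward mu (fun x : R => (x + a)%R : measurableTypeR R)]_x h x)%E.
  by rewrite ge0_integral_pushforward//= preimage_setT.
apply: eq_measure_integral => //= A mA _.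
apply/esym/lebesgue_measure_unique => //= _ [[c d]] _ <-.
rewrite /pushforward.
have -> : (fun x : R => x + a) @^-1` `]c, d]%classic = `]c - a, d - a]%classic.
  by apply/seteqP; split => x/=; rewrite !in_itv/= ltrBlDr lerBrDr.
rewrite !lebesgue_measure_itv/= !lte_fin ltrD2r; case: ifPn => // _.
by rewrite -EFinB; congr EFin; ring.
Qed.

(** The truncated power $x_+^n/n!$, which is the convolution power of order n + 1 of the indicator
    of x > 0; a count N k > 0 therefore corresponds to [pospow (N k).-1]. *)
Definition pospow (n : nat) (x : R) : R := (0 < x)%R%:R * x ^+ n / n`!%:R.

Lemma pospow_ge0 n x : 0 <= pospow n x.
Proof.
rewrite /pospow; case: ltP => [x0|_]; last by rewrite !mul0r.
by rewrite mul1r divr_ge0// exprn_ge0// ltW.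
Qed.

Lemma pospow0E x : pospow 0 x = (0 < x)%R%:R.
Proof. by rewrite /pospow expr0 fact0 mulr1 divr1. Qed.

Lemma pospow_nonpos n x : x <= 0 -> pospow n x = 0.
Proof. by rewrite leNgt /pospow => /negbTE ->; rewrite !mul0r. Qed.

Lemma measurable_pospow n : measurable_fun setT (pospow n).
Proof.
apply: measurable_funM => //; apply: measurable_funM => //.
have -> : (fun x : R => (0 < x)%R%:R : R) = \1_`]0, +oo[%classic.
  by apply/funext => x; rewrite indicE/= mem_setE in_itv/= andbT.
exact: measurable_indic.
Qed.

Lemma pospow_conv n (t : R) :
  (\int[mu]_x (pospow 0 x * pospow n (t - x))%:E = (pospow n.+1 t)%:E)%E.
Proof.
have [t0|t0] := leP t 0.
  rewrite pospow_nonpos// (eq_integral (cst 0%E)) ?integral0// => x _ /=.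
  rewrite pospow0E; case: ltP => x0; last by rewrite mul0r.
  by rewrite pospow_nonpos ?mulr0//; lra.
pose f x : R := (t - x) ^+ n / n`!%:R.
(* An antiderivative of [f] that vanishes at t, so the integral over ]0, t[ is -G(0). *)
pose G x : R := - ((t - x) ^+ n.+1 / n.+1`!%:R).
have dG (x : R) : is_derive x 1 G (f x).
  pose g : R -> R := fun x => t - x.
  have dg : is_derive x 1 g (0 - 1) := is_deriveB (is_derive_cst t x 1) (is_derive_id x 1).
  have -> : G = - (n.+1`!%:R^-1 \*: (g ^+ n.+1)).
    by apply/funext => z; rewrite /G/= fctE exprfctE/= mulrC.
  apply: is_derive_eq.
  rewrite /f /GRing.scale/= factS natrM sub0r; field.
  by rewrite nat1r !pnatr_eq0 -lt0n fact_gt0.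
have cG : continuous G.
  by move=> x; apply/differentiable_continuous/derivable1_diffP; case: (dG x).
have cf : continuous f.
  move=> x; apply: cvgM; last exact: cvg_cst.
  apply: (@continuous_comp _ _ _ (fun z => t - z) (fun z => z ^+ n)).
    by apply: cvgB; [exact: cvg_cst | exact: cvg_id].
  exact: exprn_continuous.
transitivity (\int[mu]_(x in `]0%R, t[) (f x)%:E)%E.
  rewrite [RHS]integral_mkcond; apply: eq_integral => x _.
  rewrite /patch mem_setE in_itv/= pospow0E; case: (ltP 0 x) => x0; last by rewrite mul0r.
  rewrite mul1r/=; case: (ltP x t) => xt; last by rewrite pospow_nonpos//; lra.
  by rewrite /pospow subr_gt0 xt mul1r.
rewrite integral_itv_obnd_cbnd; last first.
  by apply/measurable_EFinP/measurable_funTS; exact: continuous_measurable_fun.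
rewrite integral_itv_bndo_bndc; last first.
  by apply/measurable_EFinP/measurable_funTS; exact: continuous_measurable_fun.
rewrite (@continuous_FTC2 _ f G 0 t)//.
- rewrite /G /pospow t0 subrr subr0 -EFinB; congr EFin; rewrite expr0n/=; ring.
- by apply: continuous_subspaceT.
- split.
  + by move=> x _; case: (dG x).
  + apply: cvg_at_right_filter; exact: cG.
  + apply: cvg_at_left_filter; exact: cG.
- by move=> x _; rewrite derive1E; case: (dG x).
Qed.

(** Associativity of convolution: substituting t - x for t leaves x only in the kernels, Tonelli
    ([h] is Borel) brings the x integral inside, and [pospow_conv] evaluates it. *)
Lemma integral_pospow_conv n (h : R -> \bar R) :
  measurable_fun setT h -> (forall x, 0 <= h x)%E ->
  (\int[mu]_x ((pospow 0 x)%:E * \int[mu]_t ((pospow n t)%:E * h (x + t)%R)) =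
   \int[mu]_t ((pospow n.+1 t)%:E * h t))%E.
Proof.
move=> mh h0.
have mp k : measurable_fun [set: R] (fun x => (pospow k x)%:E).
  by apply/measurable_EFinP; exact: measurable_pospow.
have pp k x : (0 <= (pospow k x)%:E)%E by rewrite lee_fin pospow_ge0.
have mhx x : measurable_fun [set: R] (fun t => h (x + t)).
  by apply: (measurableT_comp mh); apply: measurable_funD.
have mpx k x : measurable_fun [set: R] (fun t => (pospow k (t - x))%:E).
  by apply: (measurableT_comp (mp k)); apply: measurable_funB.
transitivity (\int[mu]_x \int[mu]_t ((pospow 0 x * pospow n (t - x))%:E * h t))%E.
  apply: eq_integral => x _.
  rewrite -(@integral_shift _ (- x)); first last.
  - by move=> t; rewrite mule_ge0.
  - exact: emeasurable_funM.
  under eq_integral do rewrite (addrC x) subrK.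
  rewrite -ge0_integralZl//; first last.
  - by move=> t _; rewrite mule_ge0.
  - exact: (emeasurable_funM (mpx n x) mh).
  by apply: eq_integral => t _; rewrite muleA EFinM.
pose f (z : R * R) := ((pospow 0 z.1 * pospow n (z.2 - z.1))%:E * h z.2)%E.
have mq : measurable_fun [set: R * R] (fun z : R * R => pospow 0 z.1 * pospow n (z.2 - z.1)).
  apply: measurable_funM.
    by apply: (measurableT_comp (measurable_pospow 0)).
  by apply: (measurableT_comp (measurable_pospow n)); apply: measurable_funB.
have mf : measurable_fun setT f.
  apply: emeasurable_funM; last by apply: (measurableT_comp mh).
  exact/measurable_EFinP.
have f0 z : (0 <= f z)%E by rewrite mule_ge0// lee_fin mulr_ge0// pospow_ge0.
etransitivity; first exact: (fubini_tonelli (m1 := mu) (m2 := mu) f mf f0).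
apply: eq_integral => t _; rewrite -pospow_conv /f/=.
under eq_integral do rewrite muleC.
rewrite ge0_integralZl//; first by rewrite muleC.
- apply/measurable_EFinP.
  exact: (measurableT_comp mq (measurable_pair2 t)).
- by move=> x _; rewrite lee_fin mulr_ge0// pospow_ge0.
Qed.

(* Shifting by e restricts the integral to ]e, +oo[, which exhausts ]0, +oo[. *)
Lemma integral_pospow0_le_shift (h : R -> \bar R) (c : \bar R) :
  measurable_fun setT h -> (forall x, 0 <= h x)%E ->
  (forall e : R, (0 < e)%R -> \int[mu]_x ((pospow 0 x)%:E * h (x + e)%R) <= c)%E ->
  (\int[mu]_x ((pospow 0 x)%:E * h x) <= c)%E.
Proof.
move=> mh h0 hc.
have mp k x : measurable_fun [set: R] (fun t => (pospow k (t - x))%:E).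
  by apply/measurable_EFinP/(measurableT_comp (measurable_pospow k)); apply: measurable_funB.
have pp k x : (0 <= (pospow k x)%:E)%E by rewrite lee_fin pospow_ge0.
pose g m x := ((pospow 0 (x - m.+1%:R^-1))%:E * h x)%E.
have mg m : measurable_fun [set: R] (g m) by exact: emeasurable_funM.
have g0 m x : (0 <= g m x)%E by rewrite mule_ge0.
have ndg x : {homo g^~ x : n m / (n <= m)%N >-> (n <= m)%E}.
  move=> n m nm; rewrite /g lee_wpmul2r// lee_fin !pospow0E ler_nat.
  have mn : m.+1%:R^-1 <= n.+1%:R^-1 :> R by rewrite lef_pV2 ?posrE// ler_nat.
  case: (ltP 0 (x - n.+1%:R^-1)) => [nx|_]; last exact: leq0n.
  by rewrite (lt_le_trans nx)// lerB.
have -> : (\int[mu]_x ((pospow 0 x)%:E * h x) = \int[mu]_x limn (g^~ x))%E.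
  apply: eq_integral => x _; apply/esym/cvg_lim => //.
  rewrite /g; have [x0|x0] := leP x 0.
    under eq_fun => m.
      rewrite pospow_nonpos ?mul0e; last by rewrite subr_le0 (le_trans x0)// invr_ge0.
      over.
    by rewrite pospow_nonpos// mul0e; exact: cvg_cst.
  apply: cvg_near_cst.
  have := @near_infty_natSinv_lt R (PosNum x0); apply: filterS => m/= mx.
  by rewrite !pospow0E x0 subr_gt0 mx.
rewrite monotone_convergence//.
apply: lime_le.
  apply: ereal_nondecreasing_is_cvgn => n m nm.
  by apply: le_ge0_integral => // x; exact: ndg.
near=> m; apply: le_trans (hc m.+1%:R^-1 _); last by rewrite invr_gt0.
rewrite -(@integral_shift (g m) m.+1%:R^-1)//.
by apply: le_ge0_integral => // x; rewrite /g addrK.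
Unshelve. all: by end_near. Qed.

End OneDim.

(** * Exchanging two half-line integrals of a jointly antitone function *)

Section TwoDim.
Context {R : realType}.
Local Notation mu := (@lebesgue_measure R).
Implicit Types (F : R -> R -> \bar R) (G : R * R -> \bar R).

Definition antitone2 F := forall x x' y y' : R,
  x <= x' -> y <= y' -> (F x' y' <= F x y)%E.

(* G is the supremum of the values of F at the rational points strictly above. *)
Lemma antitone2_envelope F : (forall x y, 0 <= F x y)%E -> antitone2 F ->
  exists G, [/\ measurable_fun setT G, forall z, (0 <= G z)%E,
    forall x y, (G (x, y) <= F x y)%E &
    forall x x' y y' : R, x < x' -> y < y' -> (F x' y' <= G (x, y))%E].
Proof.
move=> F0 aF.
(* The pairs of rationals are enumerated by [unpickle], so [esups] at 0 is a countable supremum of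
   Borel functions. The default 0 is harmless because F is nonnegative. *)
pose g (k : nat) (z : R * R) : \bar R :=
  if unpickle k is Some (a, b) then
    if (z.1 < ratr a) && (z.2 < ratr b) then F (ratr a) (ratr b) else 0%E
  else 0%E.
exists (fun z => esups (g ^~ z) 0); split.
- apply: measurable_fun_esups => k; rewrite /g.
  case: (unpickle k) => [[a b]|] //.
  apply: measurable_fun_ifT => //.
  by apply: measurable_and; apply: measurable_fun_ltr.
- move=> z; rewrite /esups; apply: ereal_sup_ge.
  exists (g 0%N z); first by exists 0%N.
  by rewrite /g; case: (unpickle _) => [[a b]|] //; case: ifP.
- move=> x y; apply: ub_ereal_sup => _ [k _ <-]; rewrite /g.
  case: (unpickle k) => [[a b]|] //; case: ifP => // /andP[xa yb].
  by apply: aF; exact: ltW.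
- move=> x x' y y' xx yy.
  have [a] := rat_in_itvoo xx; rewrite in_itv/= => /andP[xa ax].
  have [b] := rat_in_itvoo yy; rewrite in_itv/= => /andP[yb by'].
  apply: ereal_sup_ge; exists (g (pickle (a, b)) (x, y)); first by exists (pickle (a, b)).
  by rewrite /g pickleK/= xa yb; apply: aF; exact: ltW.
Qed.

(** One inequality is G <= F. For the other, F at (x + e, y + e') is at most G at (x, y), and
    [integral_pospow0_le_shift] removes the shifts one variable at a time. *)
Lemma integral_pospow0_antitone2_envelope F G :
  (forall x y, 0 <= F x y)%E -> antitone2 F ->
  (forall z, 0 <= G z)%E -> (forall x y, G (x, y) <= F x y)%E ->
  (forall x x' y y' : R, x < x' -> y < y' -> (F x' y' <= G (x, y))%E) ->
  (\int[mu]_x ((pospow 0 x)%:E * \int[mu]_y ((pospow 0 y)%:E * F x y)) =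
   \int[mu]_x ((pospow 0 x)%:E * \int[mu]_y ((pospow 0 y)%:E * G (x, y))))%E.
Proof.
move=> F0 aF G0 GF FG.
have pp x : (0 <= (pospow 0 x)%:E :> \bar R)%E by rewrite lee_fin pospow_ge0.
have i0 (h : R -> \bar R) : (forall x, 0 <= h x)%E -> (0 <= \int[mu]_y ((pospow 0 y)%:E * h y))%E.
  by move=> h0; apply: integral_ge0 => y _; rewrite mule_ge0.
apply/eqP; rewrite eq_le; apply/andP; split; last first.
  apply: le_ge0_integral => x; first by rewrite mule_ge0// i0.
  rewrite lee_wpmul2l// le_ge0_integral// => y; first by rewrite mule_ge0.
  by rewrite lee_wpmul2l.
apply: integral_pospow0_le_shift.
- apply: antitone_measurable => x y xy; apply: le_ge0_integral => t; first by rewrite mule_ge0.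
  by rewrite lee_wpmul2l// aF.
- by move=> x; exact: i0.
move=> e e0; apply: le_ge0_integral => x; first by rewrite mule_ge0// i0.
rewrite lee_wpmul2l//; apply: integral_pospow0_le_shift => //.
  by apply: antitone_measurable => t y ty; rewrite aF.
move=> e' e'0; apply: le_ge0_integral => t; first by rewrite mule_ge0.
by rewrite lee_wpmul2l// FG// ltrDl.
Qed.

(** Tonelli applies to the Borel minorant G; with its arguments exchanged, G is a minorant of the
    same kind for F with its arguments exchanged. *)
Lemma integral_pospow0_swap F : (forall x y, 0 <= F x y)%E -> antitone2 F ->
  (\int[mu]_x ((pospow 0 x)%:E * \int[mu]_y ((pospow 0 y)%:E * F x y)) =
   \int[mu]_y ((pospow 0 y)%:E * \int[mu]_x ((pospow 0 x)%:E * F x y)))%E.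
Proof.
move=> F0 aF; have [G [mG G0 GF FG]] := antitone2_envelope F F0 aF.
rewrite (integral_pospow0_antitone2_envelope F G)//.
rewrite (integral_pospow0_antitone2_envelope (fun x y => F y x) (fun z => G (z.2, z.1)))//=; last 2 first.
- by move=> x x' y y' xx yy; exact: aF.
- by move=> x x' y y' xx yy; exact: FG.
have mp : measurable_fun [set: R] (fun x => (pospow 0 x)%:E).
  by apply/measurable_EFinP; exact: measurable_pospow.
have pp x : (0 <= (pospow 0 x)%:E :> \bar R)%E by rewrite lee_fin pospow_ge0.
pose f (z : R * R) := ((pospow 0 z.1)%:E * ((pospow 0 z.2)%:E * G z))%E.
have mf : measurable_fun setT f.
  apply: emeasurable_funM; first by apply: (measurableT_comp mp).
  by apply: emeasurable_funM => //; apply: (measurableT_comp mp).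
have f0 z : (0 <= f z)%E by rewrite !mule_ge0.
transitivity (\int[mu]_x \int[mu]_y f (x, y))%E.
  apply: eq_integral => x _; rewrite -ge0_integralZl//.
  - apply: (emeasurable_funM mp); exact: measurable_fun_pair2.
  - by move=> y _; rewrite mule_ge0.
etransitivity; first exact: (fubini_tonelli (m1 := mu) (m2 := mu) f mf f0).
apply: eq_integral => y _; rewrite -ge0_integralZl//.
- by apply: eq_integral => x _; rewrite muleCA.
- apply: (emeasurable_funM mp); exact: measurable_fun_pair1.
- by move=> x _; rewrite mule_ge0.
Qed.

End TwoDim.

(** * Convolution operators on functions of the aggregate, and their commutation *)

Section Smear.
Context {R : realType} {L : nat}.
Local Notation mu := (@lebesgue_measure R).
Implicit Types (F A B : ('I_L -> R) -> \bar R) (y : 'I_L -> R) (l : 'I_L).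

Definition shift_coord y l (x : R) : 'I_L -> R := fun j => y j + x *+ (j == l).

Lemma shift_coordD y l x t : shift_coord (shift_coord y l x) l t = shift_coord y l (x + t).
Proof. by apply/funext => j; rewrite /shift_coord mulrnDl addrA. Qed.

Lemma shift_coordC y l l' x t : shift_coord (shift_coord y l x) l' t = shift_coord (shift_coord y l' t) l x.
Proof. by apply/funext => j; rewrite /shift_coord addrAC. Qed.

Lemma le_shift_coord y y' l x x' : (forall j, y j <= y' j) -> x <= x' ->
  forall j, shift_coord y l x j <= shift_coord y' l x' j.
Proof. by move=> yy xx j; rewrite /shift_coord lerD// lerMn2r xx orbT. Qed.

Lemma sum_shift_coord y l x : \sum_j shift_coord y l x j = \sum_j y j + x.
Proof.
rewrite big_split/=; congr (_ + _).
by rewrite (bigD1 l)//= eqxx big1 ?addr0// => j /negbTE ->.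
Qed.

(* Convolution in coordinate l with x_+^(n-1)/(n-1)!, or with the Dirac mass at 0
   when n = 0. *)
Definition smear l n F y : \bar R :=
  if n is m.+1 then (\int[mu]_x ((pospow m x)%:E * F (shift_coord y l x)))%E else F y.

Definition smears (s : seq 'I_L) F := foldr (fun l => smear l 1) F s.

(** Vanishing once the coordinate sum reaches 1 keeps the integrals over positive shifts finite, so
    that such functions can be subtracted. *)
Definition antitone_simplex F := [/\ forall y, (0 <= F y)%E, forall y, (F y < +oo)%E,
  forall y y', (forall j, y j <= y' j) -> (F y' <= F y)%E &
  forall y, 1 <= \sum_j y j -> F y = 0%E].

(** The nonnegative differences A - B, written as a sum to avoid subtracting extended reals. *)
Definition diff_antitone F := (forall y, (0 <= F y)%E) /\
  exists A B, [/\ antitone_simplex A, antitone_simplex B & forall y, (F y + B y = A y)%E].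

Let pp n x : (0 <= (pospow n x)%:E :> \bar R)%E.
Proof. by rewrite lee_fin pospow_ge0. Qed.

Lemma smear_ge0 l n F y : (forall y, 0 <= F y)%E -> (0 <= smear l n F y)%E.
Proof. by case: n => [|n]//= F0; apply: integral_ge0 => x _; rewrite mule_ge0. Qed.

Lemma antitone_simplex_measurable F y l : antitone_simplex F ->
  measurable_fun [set: R] (fun x => F (shift_coord y l x)).
Proof.
case=> _ _ aF _; apply: antitone_measurable => x x' xx; apply: aF.
exact: le_shift_coord.
Qed.

Lemma diff_antitoneE F A B : antitone_simplex B ->
  (forall y, F y + B y = A y)%E -> F = (fun y => A y - B y)%E.
Proof.
case=> B0 Boo _ _ FBA; apply/funext => y.
by rewrite -FBA addeK// ge0_fin_numE.
Qed.

Lemma diff_antitone_measurable F y l : diff_antitone F ->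
  measurable_fun [set: R] (fun x => F (shift_coord y l x)).
Proof.
case=> F0 [A [B [mA mB FBA]]]; rewrite (diff_antitoneE F A B)//.
by apply: emeasurable_funB; apply: antitone_simplex_measurable.
Qed.

Let measurable_pospowM n (h : R -> \bar R) : measurable_fun [set: R] h ->
  measurable_fun [set: R] (fun x => (pospow n x)%:E * h x)%E.
Proof.
move=> mh; apply: emeasurable_funM => //.
by apply/measurable_EFinP; exact: measurable_pospow.
Qed.

Lemma antitone_simplex_smear1 F l : antitone_simplex F -> antitone_simplex (smear l 1 F).
Proof.
move=> [F0 Foo aF sF]; split => [y|y|y y' yy|y y1].
- exact: smear_ge0.
(* For shifts beyond [s] the coordinate sum exceeds 1 and F vanishes; for positive shifts up to [s],
   F is at most F y. *)
- pose s := Num.max 0 (1 - \sum_j y j).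
  have s0 : 0 <= s by rewrite le_max lexx.
  apply: (@le_lt_trans _ _ (\int[mu]_x (F y * (\1_(`[0, s]%classic) x)%:E))%E).
    apply: le_ge0_integral => x; first by rewrite mule_ge0.
    rewrite pospow0E indicE mem_setE in_itv/=.
    have [x0|_] := ltP 0 x; last by rewrite mul0e mule_ge0// lee_fin.
    rewrite mul1e (ltW x0)/=; have [xs|sx] := leP x s.
      rewrite mule1; apply: aF => j; rewrite /shift_coord lerDl.
      by rewrite mulrn_wge0// ltW.
    rewrite mule0 sF// sum_shift_coord.
    have : 1 - \sum_j y j <= s by rewrite le_max lexx orbT.
    by lra.
  rewrite ge0_integralZl//; last by apply/measurable_EFinP; exact: measurable_indic.
  rewrite integral_indic//= setIT lebesgue_measure_itv/= lte_fin.
  case: ifP => _; last by rewrite mule0 ltey.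
  by rewrite -EFinB lte_mul_pinfty// ?ltry// ge0_fin_numE.
- apply: le_ge0_integral => x; first by rewrite mule_ge0.
  by rewrite lee_wpmul2l//; apply: aF; exact: le_shift_coord.
- rewrite /= -(integral0 mu setT); apply: eq_integral => x _.
  rewrite pospow0E; have [x0|x0] := ltP 0 x; last by rewrite mul0e.
  by rewrite mul1e sF// sum_shift_coord; lra.
Qed.

Lemma smear1D F A B l : diff_antitone F -> antitone_simplex B ->
  (forall y, F y + B y = A y)%E ->
  forall y, (smear l 1 F y + smear l 1 B y = smear l 1 A y)%E.
Proof.
move=> gF mB FBA y /=; have [F0 _] := gF; have [B0 _ _ _] := mB.
rewrite -ge0_integralD//.
- by apply: eq_integral => x _; rewrite -FBA ge0_muleDr.
- by move=> x _; rewrite mule_ge0.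
- apply: measurable_pospowM; exact: diff_antitone_measurable.
- by move=> x _; rewrite mule_ge0.
- apply: measurable_pospowM; exact: antitone_simplex_measurable.
Qed.

Lemma diff_antitone_smear1 F l : diff_antitone F -> diff_antitone (smear l 1 F).
Proof.
move=> gF; have [F0 [A [B [mA mB FBA]]]] := gF; split=> [y|]; first exact: smear_ge0.
exists (smear l 1 A), (smear l 1 B); split; [exact: antitone_simplex_smear1..|].
exact: smear1D.
Qed.

(** This is [integral_pospow_conv] along the line through y in direction l. *)
Lemma smearS F l n : diff_antitone F -> smear l n.+1 F = smear l 1 (smear l n F).
Proof.
move=> gF; apply/funext => y; case: n => [//|n].
have [F0 _] := gF.
have mF := diff_antitone_measurable F y l gF.
transitivity (\int[mu]_x ((pospow 0 x)%:E *
    \int[mu]_t ((pospow n t)%:E * F (shift_coord y l (x + t)%R))))%E.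
  by apply/esym/(integral_pospow_conv n (fun x => F (shift_coord y l x))).
apply: eq_integral => x _ /=; congr (_ * _)%E.
by apply: eq_integral => t _; rewrite shift_coordD.
Qed.

(** F is jointly antitone in the two shift amounts, so the two integrals can be exchanged. *)
Lemma antitone_simplex_smear1C F l l' : antitone_simplex F ->
  smear l 1 (smear l' 1 F) = smear l' 1 (smear l 1 F).
Proof.
case=> F0 _ aF _; apply/funext => y /=.
pose G x t := F (shift_coord (shift_coord y l x) l' t).
have aG : antitone2 G.
  by move=> x x' t t' xx tt; apply: aF; do 2 apply: le_shift_coord => //.
etransitivity; first by apply: (integral_pospow0_swap G) => // x t; exact: F0.
apply: eq_integral => x _; congr (_ * _)%E.
by apply: eq_integral => t _; rewrite /G shift_coordC.
Qed.

Lemma smear0 F l : smear l 0 F = F.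
Proof. by []. Qed.

Lemma smearSE F l n y :
  smear l n.+1 F y = (\int[mu]_x ((pospow n x)%:E * F (shift_coord y l x)))%E.
Proof. by []. Qed.

(* Without this, closing tactics try to decide goals by unfolding the integrals. *)
#[local] Opaque smear.

(** Either order of smearing respects F = A - B, so commutation passes from A and B to F. *)
Lemma diff_antitone_smear1C F l l' : diff_antitone F ->
  smear l 1 (smear l' 1 F) = smear l' 1 (smear l 1 F).
Proof.
move=> gF; have [F0 [A [B [mA mB FBA]]]] := gF.
have E k k' : smear k 1 (smear k' 1 F) =
    (fun y => smear k 1 (smear k' 1 A) y - smear k 1 (smear k' 1 B) y)%E.
  apply: diff_antitoneE; first by do 2 apply: antitone_simplex_smear1.
  apply: smear1D; [exact: diff_antitone_smear1|exact: antitone_simplex_smear1|].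
  exact: smear1D.
by rewrite (E l l') (E l' l) (antitone_simplex_smear1C A l l' mA) (antitone_simplex_smear1C B l l' mB).
Qed.

Lemma diff_antitone_smears F s : diff_antitone F -> diff_antitone (smears s F).
Proof. by move=> gF; elim: s => //= l s; exact: diff_antitone_smear1. Qed.

Lemma smear_nseq F l n : diff_antitone F -> smear l n F = smears (nseq n l) F.
Proof. by move=> gF; elim: n => [|n IHn] /=; rewrite ?smear0// smearS// IHn. Qed.

Lemma smears_cat s t F : smears (s ++ t) F = smears s (smears t F).
Proof. exact: foldr_cat. Qed.

(** Commutation moves an occurrence of l to the front. *)
Lemma smears_rem F l s : diff_antitone F -> l \in s ->
  smears s F = smear l 1 (smears (rem l s) F).
Proof.
move=> gF; elim: s => //= a s IHs; rewrite inE; case: eqVneq => [->//|la] /= ls.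
by rewrite (IHs ls) (diff_antitone_smear1C _ a l)//; exact: diff_antitone_smears.
Qed.

Lemma perm_smears F s t : diff_antitone F -> perm_eq s t -> smears s F = smears t F.
Proof.
move=> gF; elim: s t => [|a s IHs] t st.
  by rewrite (@perm_small_eq _ t [::])// perm_sym.
have ta : a \in t by rewrite -(perm_mem st) mem_head.
rewrite (smears_rem F a t)//=; congr smear; apply: IHs.
by rewrite -(perm_cons a) (perm_trans st)// perm_to_rem.
Qed.

Definition smear_fold (s : seq ('I_L * nat)) F := foldr (fun p => smear p.1 p.2) F s.

(** A count n expands into n unit smears, so comparing two folds reduces to counting occurrences. *)
Lemma smear_foldE F s : diff_antitone F ->
  smear_fold s F = smears (flatten [seq nseq p.2 p.1 | p <- s]) F.
Proof.
move=> gF; elim: s => //= p s IHs.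
rewrite IHs smears_cat -smear_nseq//; exact: diff_antitone_smears.
Qed.

End Smear.

(** * Dirichlet probabilities as iterated convolutions *)

Section DirichletSmear.
Context {R : realType} {K L : nat} (f : 'I_K -> 'I_L) (N : 'I_K -> nat).
Local Notation mu := (@lebesgue_measure R).
#[local] Opaque smear.

(** Induction on the free coordinates. General c and y let the density factor of the first
    coordinate be absorbed into c, and its value into a shift of y. *)
Lemma iter_lebesgue_smear_fold (ks : seq 'I_K) (F : ('I_L -> R) -> \bar R) (c : R) y :
  uniq ks -> all (fun k => 0 < N k)%N ks -> diff_antitone F -> 0 <= c ->
  iter_lebesgue (size ks) (fun v =>
    ((c * \prod_(k <- ks) pospow (N k).-1 (nth 0 v (index k ks)))%:E *
     F (fun l => y l + \sum_(k <- ks | f k == l) nth 0 v (index k ks))%R)%E)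
  = (c%:E * smear_fold [seq (f k, N k) | k <- ks] F y)%E.
Proof.
elim: ks c y => [|k ks IHs] c y /=.
  move=> _ _ _ _; rewrite big_nil mulr1; congr (_ * F _)%E.
  by apply/funext => l; rewrite big_nil addr0.
move=> /andP[kks uks] /andP[Nk Nks] gF c0.
have gJ : diff_antitone (smear_fold [seq (f k, N k) | k <- ks] F).
  by rewrite smear_foldE//; exact: diff_antitone_smears.
have [J0 _] := gJ.
have pospow0 x : 0 <= pospow (N k).-1 x :> R := pospow_ge0 _ _.
transitivity (\int[mu]_x (c%:E * ((pospow (N k).-1 x)%:E *
    smear_fold [seq (f k, N k) | k <- ks] F (shift_coord y (f k) x))))%E.
  apply: eq_integral => x _; rewrite muleA -EFinM -(IHs _ _ uks Nks gF (mulr_ge0 c0 (pospow0 x))).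
  (* As k is not in [ks], prepending x only raises the other indices by one. *)
  have nthS v k' : k' \in ks ->
      nth 0 (x :: v) (if k == k' then 0%N else (index k' ks).+1) = nth 0 v (index k' ks).
    by move=> k'ks; case: eqVneq => [kk'|//]; rewrite kk' k'ks in kks.
  congr iter_lebesgue; apply/funext => v; rewrite big_cons eqxx/= mulrA.
  congr ((_ * _)%:E * F _)%E.
    by apply: eq_big_seq => k' k'ks; rewrite nthS.
  apply/funext => l; rewrite big_cons eqxx/= /shift_coord [l == _]eq_sym.
  have -> : \sum_(j <- ks | f j == l) nth 0 (x :: v) (if k == j then 0%N else (index j ks).+1) =
      \sum_(j <- ks | f j == l) nth 0 v (index j ks).
    by rewrite big_seq_cond [RHS]big_seq_cond; apply: eq_bigr => j /andP[jks _]; rewrite nthS.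
  by case: eqP => _; rewrite ?addr0 ?addrA.
rewrite ge0_integralZl//.
- by rewrite -[in RHS](prednK Nk) smearSE.
- apply: emeasurable_funM; first by apply/measurable_EFinP; exact: measurable_pospow.
  exact: diff_antitone_measurable.
- by move=> x _; rewrite mule_ge0// lee_fin.
Qed.

(** A zero count acts as the identity, like the Dirac mass at 0 of a degenerate coordinate. *)
Lemma smear_fold_filter (ks : seq 'I_K) (F : ('I_L -> R) -> \bar R) :
  smear_fold [seq (f k, N k) | k <- ks & (0 < N k)%N] F =
  smear_fold [seq (f k, N k) | k <- ks] F.
Proof.
elim: ks => //= k ks IHs; case: posnP => [Nk|_] /=; last by rewrite IHs.
by rewrite Nk smear0.
Qed.

Lemma sum_agg (th : 'I_K -> R) : \sum_l agg f th l = \sum_k th k.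
Proof. by rewrite [RHS](partition_big f xpredT). Qed.

(** What remains of the integrand once the power of each coordinate is moved into its measure: the
    constant, the event, and the constraint $Z_0 > 0$. *)
Definition sub_simplex_ind (c : R) (E : set ('I_L -> R)) (y : 'I_L -> R) : \bar R :=
  (c * (\1_E y * (\sum_l y l < 1)%R%:R))%:E.

Lemma sub_simplex_ind_diff_antitone (c : R) (E : set ('I_L -> R)) : 0 <= c ->
  (forall y y', (forall l, y l <= y' l) -> E y -> E y') ->
  diff_antitone (sub_simplex_ind c E).
Proof.
move=> c0 upE.
have ge0 D y : (0 <= sub_simplex_ind c D y)%E.
  by rewrite lee_fin !mulr_ge0// indicE.
have anti (D : set ('I_L -> R)) : (forall y y', (forall l, y l <= y' l) -> D y' -> D y) ->
    antitone_simplex (sub_simplex_ind c D).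
  move=> dnD; split=> [//|y|y y' yy|y y1].
  - by rewrite ltry.
  - have yy1 : \sum_l y l <= \sum_l y' l by apply: ler_sum => l _.
    rewrite lee_fin ler_wpM2l// ler_pM ?indicE// ler_nat.
      by case: (boolP (y' \in D)) => // /set_mem /(dnD _ _ yy) /mem_set ->.
    by case: (ltP _ 1) => // y1; rewrite (le_lt_trans yy1).
  - by rewrite /sub_simplex_ind ltNge y1 mulr0 mulr0.
(* The indicator of E is 1 minus that of its complement, which is closed downwards. *)
split=> //; exists (sub_simplex_ind c setT), (sub_simplex_ind c (~` E)); split.
- exact: anti.
- by apply: anti => y y' yy nE Ey; apply: nE; exact: upE Ey.
- move=> y; rewrite /sub_simplex_ind -EFinD -mulrDr -mulrDl !indicE in_setT in_setC.
  by case: (y \in E); rewrite ?addr0 ?add0r.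
Qed.

(** The events are compared only at nonnegative $Z_1, \ldots, Z_K$, which holds wherever the density
    is nonzero. The factorials in its denominator go into the factors [pospow]. *)
Lemma dirichlet1_smear_fold (E' : set ('I_K.+1 -> R)) (E : set ('I_L -> R)) :
  (forall y y', (forall l, y l <= y' l) -> E y -> E y') ->
  (forall z, (forall k, 0 <= z (lift ord0 k)) ->
    E' z <-> E (agg f (fun k => z (lift ord0 k)))) ->
  dirichlet1 N E' = smear_fold [seq (f k, N k) | k <- enum 'I_K]
    (sub_simplex_ind (\sum_k N k)`!%:R E) (fun=> 0).
Proof.
move=> upE EE'; set c : R := (_)`!%:R.
have gF : diff_antitone (sub_simplex_ind c E).
  by apply: sub_simplex_ind_diff_antitone.
have ufree : uniq (free_coords N) by rewrite filter_uniq// enum_uniq.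
have afree : all (fun k => 0 < N k)%N (free_coords N) by exact: filter_all.
rewrite -smear_fold_filter -[RHS]mul1e.
rewrite -(iter_lebesgue_smear_fold (free_coords N) _ 1 (fun=> 0))//.
rewrite /dirichlet1; congr iter_lebesgue; apply/funext => v; rewrite mul1r.
pose zk k : R := if (0 < N k)%N then nth 0 v (index k (free_coords N)) else 0.
have zlift k : dir_point N v (lift ord0 k) = zk k by rewrite /dir_point liftK.
have z0 : dir_point N v ord0 = 1 - \sum_k zk k by rewrite /dir_point unlift_none.
have -> : (fun l => 0 + \sum_(k <- free_coords N | f k == l) nth 0 v (index k (free_coords N)))
    = agg f zk.
  apply/funext => l; rewrite add0r /agg big_filter_cond big_enum_cond/=.
  by rewrite big_mkcondl.
have -> : \prod_(k <- free_coords N) pospow (N k).-1 (nth 0 v (index k (free_coords N))) =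
    \prod_(k | (0 < N k)%N) pospow (N k).-1 (zk k).
  rewrite big_filter big_enum_cond/=; apply: eq_bigr => k Nk.
  by rewrite /zk Nk.
rewrite /sub_simplex_ind sum_agg /dir_density z0 subr_gt0 -EFinM.
case: ifPn => [/andP[/forallP zpos z1]|].
  have zge k : 0 <= zk k.
    move: (zpos k); rewrite zlift /zk; case: ifP => //= _; exact: ltW.
  have -> : \1_E' (dir_point N v) = \1_E (agg f zk) :> R.
    have e : E' (dir_point N v) <-> E (agg f zk).
      have -> : zk = (fun k => dir_point N v (lift ord0 k)) by apply/funext.
      by apply: EE' => k; rewrite zlift.
    by rewrite !indicE; congr (nat_of_bool _)%:R; apply/idP/idP; rewrite !inE => /e.
  rewrite z1 mulr1 natr_prod -/c.
  have -> : \prod_(k | (0 < N k)%N) pospow (N k).-1 (zk k) =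
      (\prod_(k | (0 < N k)%N) dir_point N v (lift ord0 k) ^+ (N k).-1) /
      \prod_(k | (0 < N k)%N) ((N k).-1)`!%:R.
    rewrite -prodf_div; apply: eq_bigr => k Nk.
    by move: (zpos k); rewrite zlift Nk/= /pospow => ->; rewrite mul1r.
  by congr EFin; ring.
(* Off the support, either the coordinate sum is at least 1, or some free coordinate is nonpositive
   and its [pospow] factor vanishes. *)
rewrite negb_and mulr0 => /orP[/forallPn[k]|/negbTE ->]; last by rewrite !mulr0.
rewrite negb_imply zlift -leNgt => /andP[Nk zk0].
by rewrite (bigD1 k)//= pospow_nonpos// !mul0r.
Qed.

End DirichletSmear.

(** * Aggregation of the random sets and of the counts *)

Section Aggregation.
Context {R : realType} {K L : nat} (f : 'I_K -> 'I_L) (N : 'I_K -> nat).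

Lemma simplex_agg (th : 'I_K -> R) : simplex th -> simplex (agg f th).
Proof.
by move=> [th0 th1]; split; [move=> l; exact: sumr_ge0|rewrite sum_agg].
Qed.

Lemma dsm_set_agg_sub (B : set ('I_L -> R)) (z : 'I_K -> R) :
  (forall l, exists k, f k = l) -> (forall k, 0 <= z k) ->
  (forall th, simplex th -> (forall k, z k <= th k) -> B (agg f th)) <->
  (forall t, simplex t -> (forall l, agg f z l <= t l) -> B t).
Proof.
move=> /choice[g gK] z0; split=> [zB t [t0 t1] zt|zB th sth zth]; last first.
  by apply: zB; [exact: simplex_agg|move=> l; apply: ler_sum => k _].
(* The excess of t over agg f z is put on one coordinate of each block. *)
pose th k := z k + (t (f k) - agg f z (f k)) *+ (k == g (f k)).
have aggth : agg f th = t.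
  apply/funext => l; rewrite /agg big_split/= -/(agg f z l).
  rewrite [X in _ + X](bigD1 (g l)) ?gK//= eqxx big1 ?addr0 ?subrKC//.
  by move=> k /andP[/eqP -> /negbTE ->].
have zth k : z k <= th k by rewrite lerDl mulrn_wge0// subr_ge0.
rewrite -aggth; apply: zB => //; split; last by rewrite -(sum_agg f) aggth.
by move=> k; exact: le_trans (zth k).
Qed.

Lemma count_flatten_nseq (T : Type) (s : seq T) (h : T -> 'I_L) (n : T -> nat) l :
  count_mem l (flatten [seq nseq p.2 p.1 | p <- [seq (h k, n k) | k <- s]]) =
  (\sum_(k <- s | h k == l) n k)%N.
Proof.
elim: s => [|k s IHs]; first by rewrite big_nil.
by rewrite /= count_cat IHs count_nseq big_cons/=; case: eqP; rewrite ?mul1n.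
Qed.

(** In both lists l occurs $\tilde N_l$ times. *)
Lemma perm_flatten_agg_counts :
  perm_eq (flatten [seq nseq p.2 p.1 | p <- [seq (f k, N k) | k <- enum 'I_K]])
    (flatten [seq nseq p.2 p.1 | p <- [seq (l, agg_counts f N l) | l <- enum 'I_L]]).
Proof.
apply/allP => l _; apply/eqP.
rewrite (count_flatten_nseq _ _ f) (count_flatten_nseq _ _ id).
by rewrite !big_enum_cond big_pred1_eq.
Qed.

Lemma dirichlet1_dsm_agg (B : set ('I_L -> R)) : (forall l, exists k, f k = l) ->
  dirichlet1 N [set z | dsm_set z `<=` [set th | simplex th /\ B (agg f th)]] =
  dirichlet1 (agg_counts f N) [set z | dsm_set z `<=` B].
Proof.
move=> fsurj.
(* One event serves both sides, with [id] as the aggregation map on $\Theta_L$. It is closed upwards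
   because raising y leaves fewer points t to test. *)
pose E : set ('I_L -> R) := [set y | forall t, simplex t -> (forall l, y l <= t l) -> B t].
have upE y y' : (forall l, y l <= y' l) -> E y -> E y'.
  by move=> yy Ey t st yt; apply: Ey => // l; exact: le_trans (yy l) (yt l).
have agg_id (y : 'I_L -> R) : agg id y = y.
  by apply/funext => l; rewrite /agg big_pred1_eq.
rewrite (dirichlet1_smear_fold f N _ E)//; last first.
  move=> z z0; rewrite -[E _]/(forall t, _) -dsm_set_agg_sub//.
  split=> [zB th sth zth|zB th [sth zth]]; first by case: (zB th).
  by split=> //; exact: zB.
rewrite (dirichlet1_smear_fold id (agg_counts f N) _ E)//; last first.
  move=> z _; rewrite agg_id; split=> zB t => [st zt|[st zt]]; exact: zB.
have -> : (\sum_l agg_counts f N l = \sum_k N k)%N.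
  by rewrite [RHS](partition_big f xpredT).
have gF : diff_antitone (sub_simplex_ind ((\sum_k N k)`!%:R : R) E).
  exact: sub_simplex_ind_diff_antitone.
rewrite !smear_foldE//; congr (_ _).
apply: perm_smears => //; exact: perm_flatten_agg_counts.
Qed.

End Aggregation.

Theorem theorem4 (R : realType) (K L : nat) (N : 'I_K -> nat)
  (f : 'I_K -> 'I_L) (At : set ('I_L -> R)) :
  (1 <= K)%N ->
  (forall l : 'I_L, exists k : 'I_K, f k = l) ->
  At `<=` @simplex R L ->
  dsm_pqr N [set th | @simplex R K th /\ At (agg f th)] =
  dsm_pqr (agg_counts f N) At.
Proof.
move=> _ fsurj _.
have p : dsm_p N [set th | simplex th /\ At (agg f th)] = dsm_p (agg_counts f N) At.
  exact: dirichlet1_dsm_agg.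
have q : dsm_q N [set th | simplex th /\ At (agg f th)] = dsm_q (agg_counts f N) At.
  (* The complement of A is the pullback of the complement of [At], so q is handled as p was. *)
  have E : @simplex R K `\` [set th | simplex th /\ At (agg f th)] =
      [set th | simplex th /\ (@simplex R L `\` At) (agg f th)].
    apply/seteqP; split => th /= [sth nA]; split=> //.
      by split; [exact: simplex_agg|move=> Ath; apply: nA].
    by case: nA => _ nA [].
  by rewrite /dsm_q E; exact: dirichlet1_dsm_agg.
by rewrite /dsm_pqr p q.
Qed.
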